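(* Let $G$ be a graph, let $F$ be a complete-factor of $G$ with $\omega(F)\geq 2$, and let $g,f:V(G)\rightarrow \mathbb{Z}^{+}$ be two integer-valued functions with $g(x)\leq f(x)$ for any $x\in V(G)$. Let $H$ be a subgraph of $G$. If $G-V(C)$ has all fractional $(g,f)$-factors excluding $H$ for each component $C$ of $F$, then $G$ itself has all fractional $(g,f)$-factors excluding $H$.
   Context: Graphs are finite, undirected, without loops or multiple edges. $\mathbb{Z}^{+}$ is the set of positive integers. $\omega(F)$ is the number of connected components of $F$. $G-X$ is the subgraph of $G$ induced by $V(G)\setminus X$. A complete-factor of $G$ is a spanning subgraph $F$ of $G$ each of whose components is isomorphic to a complete graph $K_n$ for some $n\ge 1$ (possibly different $n$ for different components). For a graph $G'$ and $r:V(G')\to\mathbb{Z}^{+}$, a function $h:E(G')\to[0,1]$ with $\sum_{e\in E(x)}h(e)=r(x)$ for every $x\in V(G')$, where $E(x)$ is the set of edges of $G'$ incident with $x$, determines a fractional $r$-factor $F_h$ of $G'$: the subgraph with vertex set $V(G')$ and edge set $E(F_h)=\{e\in E(G'):h(e)>0\}$. $G'$ has all fractional $(g,f)$-factors excluding $H$ if for every $r:V(G')\to\mathbb{Z}^{+}$ with $g(x)\le r(x)\le f(x)$ for all $x\in V(G')$, $G'$ has a fractional $r$-factor $F_h$ with $E(H)\cap E(F_h)=\emptyset$. For $G'=G-V(C)$, the functions $g,f$ are restricted to $V(G')$, and the condition $E(H)\cap E(F_h)=\emptyset$ is used verbatim even if $H$ is not contained in $G'$. *)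

(* Defs.v *)
From HB Require Import structures.
From mathcomp Require Import all_boot all_order all_algebra.
From mathcomp Require Import reals.

Set Implicit Arguments.
Unset Strict Implicit.
Unset Printing Implicit Defensive.

Import Order.TTheory GRing.Theory Num.Theory.

Local Open Scope ring_scope.

(* A finite simple graph whose vertices are taken from the finite type T.  The
   vertex set is a subset of T, so that a graph, its subgraphs and G - X all
   live in the same type; an edge is a 2-element set of vertices.  The record
   is a subtype, hence graph T is a finType and graphs are equal exactly when
   their vertex and edge sets are. *)
Record graph (T : finType) := Graph {
  graph_val : {set T} * {set {set T}};
  _ : [forall e in graph_val.2, (e \subset graph_val.1) && (#|e| == 2)%N]
}.

HB.instance Definition _ (T : finType) := [isSub for @graph_val T].
HB.instance Definition _ (T : finType) := [Finite of graph T by <:].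

Definition verts (T : finType) (G : graph T) : {set T} := (graph_val G).1.
Definition edges (T : finType) (G : graph T) : {set {set T}} := (graph_val G).2.

Lemma edgeP (T : finType) (G : graph T) (e : {set T}) :
  e \in edges G -> (e \subset verts G) && (#|e| == 2)%N.
Proof. by case: G => p pP; exact: (forall_inP pP). Qed.

Definition adj (T : finType) (G : graph T) : rel T :=
  fun x y => [set x; y] \in edges G.

Definition subgraph (T : finType) (H G : graph T) : Prop :=
  verts H \subset verts G /\ edges H \subset edges G.

Definition spanning_subgraph (T : finType) (F G : graph T) : Prop :=
  subgraph F G /\ verts F = verts G.

Lemma induced_subproof (T : finType) (G : graph T) (X : {set T}) :
  [forall e in [set e in edges G | e \subset X],
    (e \subset verts G :&: X) && (#|e| == 2)%N].
Proof.
by apply/forall_inP => e; rewrite inE subsetI => /andP[/edgeP/andP[-> ->] ->].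
Qed.

Definition induced (T : finType) (G : graph T) (X : {set T}) : graph T :=
  @Graph T (verts G :&: X, [set e in edges G | e \subset X])
    (induced_subproof G X).

Definition del_verts (T : finType) (G : graph T) (X : {set T}) : graph T :=
  induced G (verts G :\: X).

Definition components (T : finType) (F : graph T) : {set graph T} :=
  [set induced F X | X in equivalence_partition (connect (adj F)) (verts F)].

Definition omega (T : finType) (F : graph T) : nat := #|components F|.

Lemma complete_graph_subproof (n : nat) :
  [forall e in [set e : {set 'I_n} | #|e| == 2%N],
    (e \subset [set: 'I_n]) && (#|e| == 2)%N].
Proof. by apply/forall_inP => e; rewrite inE subsetT. Qed.

Definition complete_graph (n : nat) : graph 'I_n :=
  @Graph _ ([set: 'I_n], [set e : {set 'I_n} | #|e| == 2%N])
    (complete_graph_subproof n).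

Definition isomorphic (T1 T2 : finType) (G1 : graph T1) (G2 : graph T2) : Prop :=
  exists phi : {x | x \in verts G1} -> {x | x \in verts G2},
    bijective phi /\
    forall x y, adj G1 (val x) (val y) = adj G2 (val (phi x)) (val (phi y)).

Definition complete_factor (T : finType) (F G : graph T) : Prop :=
  spanning_subgraph F G /\
  forall C, C \in components F ->
    exists n : nat, (1 <= n)%N /\ isomorphic C (complete_graph n).

(* Functions on V(G) (resp. E(G)) are total functions on T (resp. {set T}) that
   are constrained and used only on verts G (resp. edges G). *)
Definition fractional_indicator (R : realType) (T : finType) (G : graph T)
    (r : T -> nat) (h : {set T} -> R) : Prop :=
  (forall e, e \in edges G -> 0 <= h e <= 1) /\
  (forall x, x \in verts G ->
     \sum_(e in edges G | x \in e) h e = (r x)%:R).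

Lemma support_subproof (R : realType) (T : finType) (G : graph T)
    (h : {set T} -> R) :
  [forall e in [set e in edges G | 0 < h e],
    (e \subset verts G) && (#|e| == 2)%N].
Proof. by apply/forall_inP => e; rewrite inE => /andP[/edgeP]. Qed.

Definition support_graph (R : realType) (T : finType) (G : graph T)
    (h : {set T} -> R) : graph T :=
  @Graph T (verts G, [set e in edges G | 0 < h e]) (support_subproof G h).

Definition all_fractional_factors_excluding (R : realType) (T : finType)
    (G : graph T) (g f : T -> nat) (H : graph T) : Prop :=
  forall r : T -> nat,
    (forall x, x \in verts G -> (0 < r x)%N) ->
    (forall x, x \in verts G -> (g x <= r x <= f x)%N) ->
    exists h : {set T} -> R,
      fractional_indicator G r h /\
      edges H :&: edges (support_graph G h) = set0.

(* Main.v *)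
(** Put each fractional factor [h_C] of [G - V(C)] equal to zero on the edges
    meeting [C], and take [(\sum_C h_C) / (omega F - 1)].  A vertex lies in all
    but one of the graphs [G - V(C)], which gives the degree condition; an edge
    lies in at most [omega F - 1] of them, so the values stay between [0] and [1]. *)
Require Import Defs.
From mathcomp Require Import all_boot all_order all_algebra.
From mathcomp Require Import reals.

Set Implicit Arguments.
Unset Strict Implicit.
Unset Printing Implicit Defensive.

Import Order.TTheory GRing.Theory Num.Theory.

Local Open Scope ring_scope.

Lemma adj_sym (T : finType) (G : graph T) : symmetric (adj G).
Proof. by move=> x y; rewrite /adj setUC. Qed.

(** [adj F] is symmetric, so [connect] is an equivalence, and the block of [x] in its partition
    induces the required [C]. The boolean equality lets a sum over components isolate the term of
    [C]. *)
Lemma component_of_vertex (T : finType) (F : graph T) (x : T) :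
  x \in verts F ->
  exists2 C, C \in components F &
    forall D, D \in components F -> (x \in verts D) = (D == C).
Proof.
move=> xF; set P := equivalence_partition (connect (adj F)) (verts F).
have /and3P[/eqP coverP tiP _] : partition P (verts F).
  apply: equivalence_partitionP => y z t _ _ _; split=> [|yz]; first exact: connect0.
  by apply: same_connect => //; apply: sym_connect_sym; exact: adj_sym.
have xP : x \in cover P by rewrite coverP.
exists (induced F (pblock P x)); first by rewrite imset_f ?pblock_mem.
move=> _ /imsetP[X XP ->]; apply/idP/eqP => [|->].
  by rewrite inE => /andP[_ xX]; rewrite (def_pblock tiP XP xX).
by rewrite inE xF mem_pblock.
Qed.

Lemma in_edges_del_verts (T : finType) (G : graph T) (X e : {set T}) :
  (e \in edges (del_verts G X)) = (e \in edges G) && [disjoint e & X].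
Proof.
rewrite inE subsetD; case eG: (e \in edges G) => //=.
by have /andP[-> _] := edgeP eG.
Qed.

Lemma in_verts_del_verts (T : finType) (G : graph T) (X : {set T}) (x : T) :
  (x \in verts (del_verts G X)) = (x \in verts G) && (x \notin X).
Proof. by rewrite !inE; do 2!case: (_ \in _). Qed.

(** Only the component containing [x] contributes 0. This count is used both to bound edge values
    and to compute degrees. *)
Lemma not_component_count (R : realType) (T : finType) (F : graph T) (x : T) :
  x \in verts F ->
  \sum_(C in components F) (x \notin verts C)%:R = (omega F).-1%:R :> R.
Proof.
move=> /component_of_vertex[C CF CP].
rewrite (bigD1 C) //= CP // eqxx add0r /omega (cardD1 C) CF /= -sum1_card natr_sum.
apply: eq_big => [D|D /andP[DF /negPf DC]]; first by rewrite !inE andbC.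
by rewrite CP // DC.
Qed.

Theorem theorem6 (R : realType) (T : finType) (G F H : graph T) (g f : T -> nat)
    (hF : complete_factor F G) (hw : (2 <= omega F)%N)
    (hg : forall x, x \in verts G -> (0 < g x)%N)
    (hf : forall x, x \in verts G -> (0 < f x)%N)
    (hgf : forall x, x \in verts G -> (g x <= f x)%N)
    (hH : subgraph H G)
    (hC : forall C, C \in components F ->
       all_fractional_factors_excluding R (del_verts G (verts C)) g f H) :
  all_fractional_factors_excluding R G g f H.
Proof.
move=> r r_gt0 r_gf; have [[_ FG] _] := hF.
have [h hP] : exists h : graph T -> {set T} -> R, forall C, C \in components F ->
    fractional_indicator (del_verts G (verts C)) r (h C) /\
    edges H :&: edges (support_graph (del_verts G (verts C)) (h C)) = set0.
  apply: (@fin_all_exists _ _ (fun C hC => C \in components F ->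
    fractional_indicator (del_verts G (verts C)) r hC /\
    edges H :&: edges (support_graph (del_verts G (verts C)) hC) = set0)) => C.
  (* Finite choice needs a value at every graph, so non-components get the zero function. *)
  case CF: (C \in components F); last by exists (fun=> 0).
  have [x|x|h hh] := hC C CF r; last by exists h.
    by rewrite in_verts_del_verts => /andP[/r_gt0].
  by rewrite in_verts_del_verts => /andP[/r_gf].
(* Off the edges of [G - V(C)] the values of [h C] are arbitrary, hence the cut-off. *)
pose k C e := if e \in edges (del_verts G (verts C)) then h C e else 0.
have k_ge0 C e : C \in components F -> 0 <= k C e.
  move=> /hP[[h01 _] _]; rewrite /k; case: ifP => // /h01.
  by case/andP.
have k_le C (e : {set T}) x : C \in components F -> x \in e -> k C e <= (x \notin verts C)%:R.
  move=> /hP[[h01 _] _] xe; rewrite /k; case: ifP => [eC|_]; last exact: ler0n.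
  have /andP[_] := h01 e eC; move: eC; rewrite in_edges_del_verts => /andP[_ dis].
  by rewrite (disjointFr dis xe).
have w_gt0 : 0 < (omega F).-1%:R :> R by rewrite ltr0n; case: (omega F) hw => [|[]].
exists (fun e => (\sum_(C in components F) k C e) / (omega F).-1%:R).
split; first split.
- move=> e eG; have /andP[eV /eqP e2] := edgeP eG.
  (* Any endpoint [x] of [e] will do: summing [k_le] at [x] over the components gives at most
     [omega F - 1]. *)
  have [x xe] : exists x, x \in e by apply/set0Pn; rewrite -card_gt0 e2.
  rewrite divr_ge0 ?sumr_ge0 ?ler0n //=; last by move=> C; exact: k_ge0.
  rewrite ler_pdivrMr // mul1r -(@not_component_count _ _ F x).
    by apply: ler_sum => C CF; exact: k_le.
  by rewrite FG (subsetP eV).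
- move=> x xG; rewrite -mulr_suml exchange_big /=.
  apply: (canLR (mulfK (lt0r_neq0 w_gt0))).
  (* Writing [omega F - 1] as a sum of indicators reduces the degree condition to one identity per
     component. *)
  rewrite -(@not_component_count _ _ F x) ?FG // mulr_sumr.
  apply: eq_bigr => C CF; have [[_ hr] _] := hP C CF.
  (* If [x] lies in [C], every edge at [x] meets [C] and both sides vanish; otherwise the left side
     is the degree of [x] under [h C]. *)
  case: (boolP (x \in verts C)) => xC.
    rewrite mulr0 big1 // => e /andP[_ xe]; apply/le_anti.
    by rewrite k_ge0 // andbT (le_trans (k_le _ _ x CF xe)) // xC.
  rewrite mulr1 -hr ?in_verts_del_verts ?xG // [LHS]big_mkcond [RHS]big_mkcond.
  apply: eq_bigr => e _; rewrite /k in_edges_del_verts.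
  by case: (e \in edges G); case: (x \in e); case: [disjoint _ & _].
apply/setP => e; rewrite !inE; apply/negP => /and3P[eH eG].
(* For an edge of [H], each [k C e] is 0: either [e] meets [C], or [h C e] is nonnegative but not
   positive. *)
rewrite pmulr_lgt0 ?invr_gt0 // big1 ?ltxx // => C CF.
have [[h01 _] /setP/(_ e)] := hP C CF.
rewrite /k; case: ifP => // eC.
rewrite inE [e \in edges (support_graph _ _)]in_set eH eC in_set0 => /negbT; rewrite -leNgt => hle.
by apply/le_anti; rewrite hle; case/andP: (h01 e eC) => ->.
Qed.
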